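(* There are absolute constants $c,c'>0$ such that for all (sufficiently large) odd $n$, every deletion probability $\delta\ge c/\sqrt n$ (in particular every constant $\delta\in(0,1)$) and every scaling factor $0<\alpha\le c'\sqrt n$, the statistical (total variation) distance between the distribution of a single trace from $S_e$ and the distribution of a single trace from $S_o$ is $e^{-\Omega(\sqrt n)}$.
   Context: Let $bin(n,p,k)=\binom nk p^k(1-p)^{n-k}$. For odd $n$ and a parameter $\alpha>0$, $S_e$ and $S_o$ are strings of $n+1$ probabilities indexed by $i\in\{0,\ldots,n\}$: $S_e(i)=\alpha\,bin(n,\tfrac12,i)$ for even $i$ and $S_e(i)=0$ for odd $i$; $S_o(i)=\alpha\,bin(n,\tfrac12,i)$ for odd $i$ and $S_o(i)=0$ for even $i$. A trace of a string of probabilities $p_0,\ldots,p_n$ with deletion probability $\delta$ is obtained by sampling independent bits $t_i$ with $\Pr[t_i=1]=p_i$, then deleting each bit independently with probability $\delta$ and concatenating the surviving bits. *)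

(* Defs.v *)
From HB Require Import structures.
From mathcomp Require Import all_boot all_order all_algebra.
From mathcomp Require Import all_classical all_reals all_analysis.
Set Implicit Arguments. Unset Strict Implicit. Unset Printing Implicit Defensive.
Import Order.TTheory GRing.Theory Num.Theory.
Local Open Scope ring_scope.

Definition binp {R : realType} (n : nat) (p : R) (k : nat) : R :=
  ('C(n, k))%:R * p ^+ k * (1 - p) ^+ (n - k).

Definition S_e {R : realType} (n : nat) (alpha : R) (i : nat) : R :=
  if ~~ odd i then alpha * binp n (2^-1) i else 0.

Definition S_o {R : realType} (n : nat) (alpha : R) (i : nat) : R :=
  if odd i then alpha * binp n (2^-1) i else 0.

(* An outcome of the trace process on a string p_0..p_n: for each position
   i in {0..n}, the sampled bit t_i and whether it is deleted. *)
Definition trace_outcome (n : nat) := {ffun 'I_n.+1 -> bool * bool}.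

Definition outcome_weight {R : realType} (n : nat) (p : nat -> R) (delta : R)
  (x : trace_outcome n) : R :=
  \prod_(i < n.+1)
    ((if (x i).1 then p i else 1 - p i) * (if (x i).2 then delta else 1 - delta)).

Definition trace_of (n : nat) (x : trace_outcome n) : seq bool :=
  [seq (x i).1 | i <- enum 'I_n.+1 & ~~ (x i).2].

Definition trace_prob {R : realType} (n : nat) (p : nat -> R) (delta : R)
  (y : seq bool) : R :=
  \sum_(x : trace_outcome n | trace_of x == y) outcome_weight p delta x.

(* Total variation distance between the trace distributions of two strings
   of n+1 probabilities; every trace has length <= n+1. *)
Definition trace_tv {R : realType} (n : nat) (p q : nat -> R) (delta : R) : R :=
  2^-1 * \sum_(m < n.+2) \sum_(y : m.-tuple bool)
           `|trace_prob n p delta (tval y) - trace_prob n q delta (tval y)|.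

(* Main.v *)
(* A trace is a product, in the free algebra on the two bits, of the factors
   [Z + p_i U], where [Z] is a zero thinned by deletion and [U] is the effect of
   replacing this zero by a one; twice the total variation distance is the l1
   norm of the difference of two such products. Expanding in [U], the term with
   [k] marks at [i_1 < ... < i_k] (all even or all odd) carries the weight
   [prod_l alpha 'C(n, i_l) / 2 ^ n] and the sign [(-1) ^ i_1], and it reads
   [Z ^ i_1 W Z ^ (n - i_k)] where [W] depends only on the gaps.

   Writing each ['C(n, i_l)] as a Vandermonde convolution over about
   [sqrt n / 2] blocks of [r ~ 2 sqrt n] coordinates, one may shift all marks by
   one inside a single block. This flips the sign, changes the weight by a
   bounded factor with constant probability as long as [k] is at most [r / 20],
   and only moves one [Z] from the left of [W] to the right. Next to a batch of
   [1 / (4 delta) <= sqrt n / 4] further copies of [Z] on each side such a move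
   is hidden by the deletions with constant probability. Hence every block
   gains a constant factor and the terms with [k <= r / 20] lose a factor
   [exp (- Omega (sqrt n))]. The remaining ones are small because the sum over
   [k] is dominated by the exponential series of [8 alpha], with
   [alpha <= c' sqrt n] and [c'] small. *)
Require Import Defs.
From HB Require Import structures.
From mathcomp Require Import all_boot all_order all_algebra.
From mathcomp Require Import all_classical all_reals all_analysis.
From mathcomp Require Import ring lra zify.
Set Implicit Arguments. Unset Strict Implicit. Unset Printing Implicit Defensive.
Import Order.TTheory GRing.Theory Num.Theory.
Local Open Scope ring_scope.

(** * Overlap of products of binomial weights with their unit shift *)

Section BinomialOverlap.
Variable R : realType.

Lemma sum_bin_pascal n (f : nat -> R) :
  \sum_(j < n.+2) 'C(n.+1, j)%:R * f j =
  \sum_(j < n.+1) 'C(n, j)%:R * (f j + f j.+1).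
Proof.
rewrite big_ord_recl bin0 (eq_bigr (fun j : 'I_n.+1 =>
    'C(n, j.+1)%:R * f j.+1 + 'C(n, j)%:R * f j.+1)); last first.
  by move=> j _; rewrite /= /bump /= add1n binS natrD mulrDl.
rewrite big_split /= addrA.
have -> : 1%:R * f (@ord0 n.+1) + \sum_(j < n.+1) 'C(n, j.+1)%:R * f j.+1 =
    \sum_(j < n.+1) 'C(n, j)%:R * f j.
  rewrite big_ord_recr /= bin_small // mul0r addr0 [RHS]big_ord_recl bin0.
  by congr (_ + _).
by rewrite -big_split; apply: eq_bigr => j _; rewrite mulrDr.
Qed.

Lemma sum_binR n : \sum_(j < n.+1) 'C(n, j)%:R = 2 ^+ n :> R.
Proof.
under eq_bigr do rewrite -[_%:R]mulr1.
elim: n => [|n IHn]; first by rewrite big_ord1 bin0 mulr1 expr0.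
by rewrite (sum_bin_pascal n (fun=> 1)) -mulr_suml exprSr -IHn -mulr_suml mulr1.
Qed.

(** This is the variance of a sum of [n] independent signs, scaled by [2 ^+ n]; Pascal's rule gives
    the induction. *)
Lemma sum_bin_var n :
  \sum_(j < n.+1) 'C(n, j)%:R * (2 * j%:R - n%:R) ^+ 2 = n%:R * 2 ^+ n :> R.
Proof.
elim: n => [|n IHn].
  by rewrite big_ord1 mulr0 subr0 expr0n mulr0 mul0r.
rewrite (sum_bin_pascal n (fun j => (2 * j%:R - n.+1%:R) ^+ 2)).
under eq_bigr => j _.
  have -> : 'C(n, j)%:R * ((2 * j%:R - n.+1%:R) ^+ 2 +
      (2 * j.+1%:R - n.+1%:R) ^+ 2) =
      2 * ('C(n, j)%:R * (2 * j%:R - n%:R) ^+ 2) + 2 * 'C(n, j)%:R :> R.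
    by rewrite -!natr1; ring.
  over.
rewrite big_split -!mulr_sumr /= IHn sum_binR -natr1 exprSr; ring.
Qed.

(** Row [r] shifted by one. The value at 0 must be 0, whereas ['C(r, j.-1)] would give 1. *)
Definition binpred r j : R := if j is j'.+1 then 'C(r, j')%:R else 0.

Lemma binpred_ge0 r j : 0 <= binpred r j.
Proof. by case: j => //= j. Qed.

Lemma binpredE r j : binpred r j * r.+1%:R = 'C(r.+1, j)%:R * j%:R.
Proof.
case: j => [|j] /=; first by rewrite mul0r mulr0.
by rewrite -!natrM mulnC mul_bin_diag mulnC.
Qed.

Lemma binE r j : (j <= r.+1)%N ->
  'C(r, j)%:R * r.+1%:R = 'C(r.+1, j)%:R * (r.+1%:R - j%:R) :> R.
Proof.
by move=> jr; rewrite -natrB // -!natrM mulnC (mul_bin_down r.+1 j) mulnC.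
Qed.

(** Both [j.-1] and [j] then stay at distance at least [h] from the ends 0 and [r]. *)
Definition central h r j := (h < j <= r - h)%N.

(* The harmonic mean of ['C(r, j.-1)] and ['C(r, j)], a rational substitute for
   their geometric mean. *)
Definition overlap h r j : R :=
  if central h r j then
    2 * 'C(r.+1, j)%:R * (j%:R * (r.+1%:R - j%:R)) / r.+1%:R ^+ 2
  else 0.

Lemma overlap_ge0 h r j : (j <= r.+1)%N -> 0 <= overlap h r j.
Proof.
move=> jr; rewrite /overlap; case: ifP => // _.
by rewrite !mulr_ge0 ?invr_ge0 ?exprn_ge0 // subr_ge0 ler_nat.
Qed.

(** The harmonic mean is at most the geometric one: the quotient of the two sides is
    [4 x (n - x) / n ^ 2]. *)
Lemma overlap_sqr_le h r j : (j <= r.+1)%N ->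
  overlap h r j ^+ 2 <= binpred r j * 'C(r, j)%:R.
Proof.
move=> jr; rewrite /overlap; case: ifP => _; last first.
  by rewrite expr0n mulr_ge0 ?binpred_ge0.
set n : R := r.+1%:R; have n0 : 0 < n by rewrite ltr0n.
have nn0 : n != 0 by rewrite gt_eqF.
have -> : binpred r j = 'C(r.+1, j)%:R * j%:R / n.
  by rewrite -binpredE mulfK.
have -> : 'C(r, j)%:R = 'C(r.+1, j)%:R * (n - j%:R) / n :> R.
  by rewrite -binE // mulfK.
set c : R := 'C(r.+1, j)%:R; set x : R := j%:R.
have xn : 0 <= n - x by rewrite subr_ge0 ler_nat.
have x0 : 0 <= x by [].
have -> : (2 * c * (x * (n - x)) / n ^+ 2) ^+ 2 =
    (c * x / n * (c * (n - x) / n)) * (4 * x * (n - x) / n ^+ 2) by field.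
rewrite ler_piMr //; first by rewrite !mulr_ge0 ?invr_ge0 // ltW.
by rewrite ler_pdivrMr ?exprn_gt0 // mul1r; have := sqr_ge0 (2 * x - n); nra.
Qed.

Lemma sum_overlap_ge h r : (4 * h.+1 <= r.+1)%N ->
  2 ^+ r * (1 - 4 / r.+1%:R) <= \sum_(j < r.+2) overlap h r j.
Proof.
move=> hr; set n : R := r.+1%:R; have n0 : 0 < n by rewrite ltr0n.
have nn0 : n != 0 by rewrite gt_eqF.
(* Untruncated, [overlap] is [c (1 / 2 - (2 x - n) ^ 2 / (2 n ^ 2))]. Raising the last coefficient
   from 1/2 to 2 makes the summand nonpositive once [|2 x - n| >= n / 2], hence at every truncated
   [j]. *)
have -> : 2 ^+ r * (1 - 4 / n) =
    \sum_(j < r.+2) ('C(r.+1, j)%:R / 2 -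
       2 / n ^+ 2 * ('C(r.+1, j)%:R * (2 * j%:R - n) ^+ 2)).
  rewrite big_split /= -mulr_suml sum_binR sumrN -mulr_sumr sum_bin_var -/n.
  by rewrite exprSr; field.
apply: ler_sum => j _; rewrite /overlap.
have jr : (j <= r.+1)%N by rewrite -ltnS.
set c : R := 'C(r.+1, j)%:R; set x : R := j%:R.
have c0 : 0 <= c by [].
case: ifP => cj.
  rewrite -subr_ge0; set e := (X in 0 <= X).
  have -> : e = 3 / 2 * c * ((2 * x - n) ^+ 2 / n ^+ 2) by rewrite /e; field.
  by rewrite mulr_ge0 ?divr_ge0 ?sqr_ge0 // mulr_ge0 ?divr_ge0.
have far : n / 2 <= `|2 * x - n|.
  move: cj; rewrite /central; case: (ltnP h j) => /= hj jh.
    have : (3 * r.+1 <= 4 * j)%N by lia.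
    rewrite -(ler_nat R) !natrM -/n -/x => ?.
    by rewrite ger0_norm; lra.
  have : (4 * j <= r.+1)%N by lia.
  rewrite -(ler_nat R) !natrM -/n -/x => ?.
  by rewrite ler0_norm; lra.
have far2 : n ^+ 2 / 4 <= (2 * x - n) ^+ 2.
  rewrite -(real_normK (num_real (2 * x - n))).
  by have := ler_pM _ _ far far; rewrite -!expr2; nra.
have -> : c / 2 - 2 / n ^+ 2 * (c * (2 * x - n) ^+ 2) =
   2 / n ^+ 2 * c * (n ^+ 2 / 4 - (2 * x - n) ^+ 2) by field.
by rewrite mulr_ge0_le0 ?subr_le0 // mulr_ge0 // divr_ge0 ?sqr_ge0.
Qed.

Variable I : finType.
Implicit Types v : I -> nat.

Definition vals m (v : {ffun I -> 'I_m}) : I -> nat := fun l => v l.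

Definition wt r v : R := \prod_l 'C(r, v l)%:R.
Definition wtpred r v : R := \prod_l binpred r (v l).

Lemma wt_ge0 r v : 0 <= wt r v.
Proof. exact: prodr_ge0. Qed.

Lemma wtpred_ge0 r v : 0 <= wtpred r v.
Proof. by apply: prodr_ge0 => l _; exact: binpred_ge0. Qed.

Lemma sum_wt r : \sum_(v : {ffun I -> 'I_r.+1}) wt r (vals v) = (2 ^+ r) ^+ #|I|.
Proof.
rewrite -(bigA_distr_bigA (fun (_ : I) (j : 'I_r.+1) => 'C(r, j)%:R : R)) /=.
by rewrite sum_binR prodr_const.
Qed.

Lemma sum_wt_wide r : \sum_(v : {ffun I -> 'I_r.+2}) wt r (vals v) = (2 ^+ r) ^+ #|I|.
Proof.
rewrite -(bigA_distr_bigA (fun (_ : I) (j : 'I_r.+2) => 'C(r, j)%:R : R)) /=.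
by rewrite big_ord_recr /= bin_small // addr0 sum_binR prodr_const.
Qed.

Lemma sum_wtpred r :
  \sum_(v : {ffun I -> 'I_r.+2}) wtpred r (vals v) = (2 ^+ r) ^+ #|I|.
Proof.
rewrite -(bigA_distr_bigA (fun (_ : I) (j : 'I_r.+2) => binpred r j)) /=.
by rewrite big_ord_recl /= add0r sum_binR prodr_const.
Qed.

Lemma bernoulli_le (x : R) m : 0 <= x <= 1 -> 1 - m%:R * x <= (1 - x) ^+ m.
Proof.
move=> /andP[x0 x1]; elim: m => [|m IHm]; first by rewrite expr0 mul0r subr0.
have e0 : 0 <= 1 - x by rewrite subr_ge0.
have := ler_wpM2l e0 IHm; rewrite -exprS -(addn1 m) natrD.
by have := mulr_ge0 (ler0n R m) (mulr_ge0 x0 x0); nra.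
Qed.

(* With [E] the product of the harmonic means, [E ^+ 2 <= min * max], hence
   [E <= min + max / 4]; now sum over [v]. *)
Lemma sum_min_wt_ge h r : (4 * h.+1 <= r.+1)%N -> (20 * #|I| <= r.+1)%N ->
  (2 ^+ r) ^+ #|I| / 4 <=
  \sum_(v : {ffun I -> 'I_r.+2} | [forall l, central h r (v l)])
     Num.min (wtpred r (vals v)) (wt r (vals v)).
Proof.
move=> hr kr; set W := (2 ^+ r) ^+ #|I|; set S := (X in _ <= X).
have W0 : 0 <= W by rewrite !exprn_ge0.
have n0 : 0 < r.+1%:R :> R by rewrite ltr0n.
pose x : R := 4 / r.+1%:R.
have nx : r.+1%:R * x = 4 by rewrite /x mulrC divfK // gt_eqF.
have r4 : 4 <= r.+1%:R :> R by rewrite (ler_nat R 4) (leq_trans _ hr) // mulnS.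
have x01 : 0 <= x <= 1.
  by rewrite divr_ge0 ?(ltW n0) //= ler_pdivrMr // mul1r.
(* Bernoulli's inequality loses at most [4 #|I| / r.+1 <= 1 / 5]; the final bound uses
   [4 / 5 - 1 / 2 >= 1 / 4]. *)
have lower : W * (4 / 5) <=
    \sum_(v : {ffun I -> 'I_r.+2}) \prod_l overlap h r (v l).
  rewrite -(bigA_distr_bigA (fun (_ : I) (j : 'I_r.+2) => overlap h r j)) /=.
  rewrite prodr_const.
  have b1 : (2 ^+ r * (1 - x)) ^+ #|I| <=
      (\sum_(j < r.+2) overlap h r j) ^+ #|I|.
    rewrite lerXn2r ?nnegrE ?sum_overlap_ge //.
      by rewrite mulr_ge0 ?exprn_ge0 // subr_ge0; case/andP: x01.
    by apply: sumr_ge0 => j _; rewrite overlap_ge0 // -ltnS.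
  apply: le_trans b1; rewrite exprMn ler_wpM2l //.
  apply: le_trans (bernoulli_le #|I| x01).
  move: kr; rewrite -(ler_nat R) natrM => kr.
  case/andP: x01 => x0 _; have := ler_wpM2r x0 kr; rewrite nx; lra.
have upper : \sum_(v : {ffun I -> 'I_r.+2}) \prod_l overlap h r (v l) <=
    S + W / 2.
  have -> : W / 2 = \sum_(v : {ffun I -> 'I_r.+2}) (wtpred r (vals v) + wt r (vals v)) / 4.
    by rewrite -mulr_suml big_split /= sum_wt_wide sum_wtpred -/W; lra.
  rewrite /S [X in _ <= X + _]big_mkcond -big_split /=; apply: ler_sum => v _.
  have w0 := wt_ge0 r (vals v); have w'0 := wtpred_ge0 r (vals v).
  have p0 : 0 <= \prod_l overlap h r (v l).
    by apply: prodr_ge0 => l _; rewrite overlap_ge0 // -ltnS.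
  case: ifPn => [_|/forallPn[l hl]]; last first.
    rewrite (bigD1 l) //= {1}/overlap (negPf hl) mul0r add0r.
    by rewrite mulr_ge0 ?addr_ge0.
  have sq : (\prod_l overlap h r (v l)) ^+ 2 <= wtpred r (vals v) * wt r (vals v).
    rewrite -prodrXl /wtpred /wt -big_split /=; apply: ler_prod => l _.
    by rewrite sqr_ge0 overlap_sqr_le // -ltnS.
  set E := \prod_l _ in p0 sq *.
  set a := wtpred r (vals v) in w'0 sq *; set b := wt r (vals v) in w0 sq *.
  set m := Num.min a b.
  have m0 : 0 <= m by rewrite le_min w0 w'0.
  suff : E ^+ 2 <= (m + (a + b) / 4) ^+ 2.
    by rewrite ler_sqr ?nnegrE // addr_ge0 ?mulr_ge0 ?addr_ge0.
  apply: (le_trans sq); rewrite /m.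
  have := sqr_ge0 (a - b / 4); have := sqr_ge0 (b - a / 4).
  have := mulr_ge0 w0 w'0; have := sqr_ge0 (a - b).
  by have [ab|ba] := leP a b; nra.
by have := le_trans lower upper; lra.
Qed.

End BinomialOverlap.

(** * Sums against products of binomial weights *)

Section WeightedSums.
Variables (R : realType) (E : lmodType R) (I : finType).

(** Up to the factor [2 ^ (r #|I|)], the mean of [F] at independent binomial coordinates with
    parameters [r] and 1/2. *)
Definition wsum r (F : (I -> nat) -> E) : E :=
  \sum_(v : {ffun I -> 'I_r.+1}) wt R r (vals v) *: F (vals v).

(** Used with two embeddings of ['I_r.+1] into ['I_r.+2], so that a weighted sum and its translate
    run over the same families. *)
Lemma sum_ffun_inj (J J' : finType) (g : J -> J') (c : J' -> R)
    (F : {ffun I -> J'} -> E) :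
  injective g -> (forall j, j \notin codom g -> c j = 0) ->
  \sum_(v : {ffun I -> J'}) (\prod_l c (v l)) *: F v =
  \sum_(u : {ffun I -> J}) (\prod_l c (g (u l))) *: F [ffun l => g (u l)].
Proof.
move=> g_inj c0; pose G (u : {ffun I -> J}) : {ffun I -> J'} := [ffun l => g (u l)].
have G_inj : injective G.
  move=> u u' /ffunP e; apply/ffunP => l; apply: g_inj.
  by have := e l; rewrite !ffunE.
rewrite (bigID (fun v => v \in G @: [set: {ffun I -> J}])) /=.
rewrite [X in _ + X]big1 ?addr0 => [|v vG]; last first.
  suff [l hl] : exists l, v l \notin codom g.
    by rewrite (bigD1 l) //= c0 // mul0r scale0r.
  apply/existsP; rewrite -negb_forall; apply: contra vG => /forallP h.
  apply/imsetP; exists [ffun l => iinv (h l)]; first by rewrite inE.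
  by apply/ffunP => l; rewrite !ffunE f_iinv.
rewrite big_imset /=; last by move=> ? ? _ _; exact: G_inj.
rewrite big_set /=; apply: eq_bigr => u _; congr (_ *: _).
by apply: eq_bigr => l _; rewrite ffunE.
Qed.

Lemma wsum_wide r F :
  wsum r F =
  \sum_(v : {ffun I -> 'I_r.+2}) wt R r (vals v) *: F (vals v).
Proof.
rewrite /wsum (@sum_ffun_inj _ _ (widen_ord (leqnSn r.+1))
  (fun j : 'I_r.+2 => 'C(r, j)%:R) (fun v => F (vals v))) /=.
- apply: eq_bigr => u _; congr (_ *: F _).
  by apply: funext => l; rewrite /vals ffunE.
- by move=> j j' /(congr1 val) /= /val_inj.
- move=> j; case: (ltnP j r.+1) => [jr|jr _]; last by rewrite bin_small.
  move/negP; case; apply/codomP; exists (Ordinal jr); exact: val_inj.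
Qed.

Lemma wsum_pred r F :
  wsum r F =
  \sum_(v : {ffun I -> 'I_r.+2}) wtpred R r (vals v) *: F (fun l => (v l).-1).
Proof.
rewrite /wsum (@sum_ffun_inj _ _ (lift ord0)
  (fun j : 'I_r.+2 => binpred R r j) (fun v => F (fun l => (v l).-1))) /=.
- apply: eq_bigr => u _; congr (_ *: F _).
  by apply: funext => l; rewrite /vals ffunE.
- exact: lift_inj.
- move=> j; case: (unliftP ord0 j) => [j' -> /negP[]|-> //].
  exact: codom_f.
Qed.

Lemma sum_bin_pair r s m :
  (\sum_(p : 'I_r.+1 * 'I_s.+1 | p.1 + p.2 == m) 'C(r, p.1) * 'C(s, p.2) =
    'C(r + s, m))%N.
Proof.
pose f a := ('C(r, a) * if a <= m then 'C(s, m - a) else 0)%N.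
(* Terms with index above [r] or above [m] vanish, so both ranges extend to a common one. *)
have widen n : (minn r m < n <= (r + m).+1)%N ->
    (\sum_(a < n) f a = \sum_(a < (r + m).+1) f a)%N.
  move=> /andP[h1 h2]; rewrite (big_ord_widen _ f h2) big_mkcond /=.
  apply: eq_bigr => a _; case: ifP => // /negbT; rewrite -leqNgt => na.
  rewrite /f; case: leqP => am; last by rewrite muln0.
  by rewrite bin_small //; have := geq_minr r m; lia.
rewrite -binomial.Vandermonde.
transitivity (\sum_(a < m.+1) f a)%N; last first.
  by apply: eq_bigr => a _; rewrite /f -ltnS ltn_ord.
rewrite (widen m.+1) ?ltnS ?geq_minr ?leq_addl // -(widen r.+1); last first.
  by rewrite !ltnS geq_minl leq_addr.
rewrite -(pair_big_dep xpredT (fun (a : 'I_r.+1) (b : 'I_s.+1) => a + b == m)%N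
  (fun (a : 'I_r.+1) (b : 'I_s.+1) => 'C(r, a) * 'C(s, b)))%N /=.
apply: eq_bigr => a _; rewrite /f; case: leqP => am; last first.
  by rewrite muln0 big_pred0 // => b; apply/negbTE/eqP; lia.
case: (ltnP (m - a) s.+1) => ms; last first.
  rewrite (bin_small ms) muln0 big_pred0 // => b; apply/negbTE/eqP.
  by have := ltn_ord b; lia.
rewrite (big_pred1 (Ordinal ms)) // => b; apply/eqP/eqP => [h|->/=].
  by apply: val_inj => /=; lia.
by lia.
Qed.

(** A sum of independent binomials is binomial: Vandermonde's convolution in each coordinate. *)
Lemma wsum_add r s F :
  wsum r (fun v => wsum s (fun u => F (fun l => v l + u l)%N)) = wsum (r + s) F.
Proof.
pose J := ('I_r.+1 * 'I_s.+1)%type.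
pose c (p : J) : R := 'C(r, p.1)%:R * 'C(s, p.2)%:R.
pose S (t : {ffun I -> J}) : {ffun I -> 'I_(r + s).+1} :=
  [ffun l => inord ((t l).1 + (t l).2)].
have ltS (p : J) : (p.1 + p.2 < (r + s).+1)%N.
  by have := ltn_ord p.1; have := ltn_ord p.2; lia.
transitivity (\sum_(t : {ffun I -> J}) (\prod_l c (t l)) *: F (vals (S t))).
  rewrite /wsum; under eq_bigr do rewrite scaler_sumr.
  rewrite pair_big /=.
  rewrite (reindex (fun t : {ffun I -> J} =>
      ([ffun l => (t l).1], [ffun l => (t l).2]))) /=.
    apply: eq_bigr => t _; rewrite scalerA /wt -big_split /=; congr (_ *: F _).
      by apply: eq_bigr => l _; rewrite /vals !ffunE.
    by apply: funext => l; rewrite /vals !ffunE inordK.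
  exists (fun p : {ffun I -> 'I_r.+1} * {ffun I -> 'I_s.+1} =>
      [ffun l => (p.1 l, p.2 l)]) => [t _|[v u] _].
    by apply/ffunP => l; rewrite !ffunE /=; case: (t l).
  by congr pair; apply/ffunP => l; rewrite !ffunE.
rewrite (partition_big S predT) //=; apply: eq_bigr => i _.
under eq_bigr => t /eqP -> do [].
rewrite -scaler_suml; congr (_ *: _).
have -> : wt R (r + s) (vals i) =
    \prod_l \sum_(p : J | (p.1 + p.2 == i l)%N) c p.
  apply: eq_bigr => l _; rewrite -(sum_bin_pair r s) natr_sum.
  by apply: eq_bigr => p _; rewrite natrM.
rewrite bigA_distr_big_dep; apply: eq_bigl => t.
apply/eqP/familyP => [<- l|h]; first by rewrite unfold_in /= ffunE inordK.
apply/ffunP => l; apply: val_inj; have := h l; rewrite unfold_in /= => /eqP <-.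
by rewrite ffunE inordK.
Qed.

End WeightedSums.

(** * Subsets as images of injections, and the parity sign *)

Lemma sum_set_inj (R : realType) (E : lmodType R) m (f : {set 'I_m} -> E) :
  \sum_(J : {set 'I_m}) f J =
  \sum_(k < m.+1) (k`!%:R^-1 : R) *:
    \sum_(v : {ffun 'I_k -> 'I_m} | injectiveb v) f (v @: [set: 'I_k]).
Proof.
have cardm (J : {set 'I_m}) : (#|J| < m.+1)%N.
  by rewrite ltnS (leq_trans (max_card _)) // card_ord.
rewrite (partition_big (fun J => Ordinal (cardm J)) predT) //=.
apply: eq_bigr => k _.
rewrite [X in _ *: X](partition_big (fun v : {ffun 'I_k -> 'I_m} =>
  v @: [set: 'I_k]) (fun J => #|J| == k)) /=; last first.
  by move=> v /injectiveP vi; rewrite card_imset // cardsT card_ord.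
rewrite scaler_sumr; apply: eq_big => [J|J /eqP Jk]; first by rewrite -val_eqE.
have {}Jk : #|J| = k by rewrite -Jk.
have -> : \sum_(v : {ffun 'I_k -> 'I_m} | injectiveb v && (v @: [set: 'I_k] == J))
    f (v @: [set: 'I_k]) =
    \sum_(v in [set v : {ffun 'I_k -> 'I_m} in ffun_on (mem J) | injectiveb v]) f J.
  apply: eq_big => [v|v /andP[_ /eqP ->] //].
  rewrite inE; case: injectiveP => vi; rewrite ?andbF //= andbT.
  apply/eqP/ffun_onP => [<- l|vJ]; first exact: imset_f.
  apply/eqP; rewrite eqEcard card_imset // cardsT card_ord Jk leqnn andbT.
  by apply/fintype.subsetP => _ /imsetP[l _ ->].
rewrite sumr_const card_inj_ffuns_on Jk card_ord ffactnn -(scaler_nat _ (f J)) scalerA.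
by rewrite mulVf ?scale1r // pnatr_eq0 -lt0n fact_gt0.
Qed.

Lemma binp_half (R : realType) n i : (i <= n)%N ->
  binp n 2^-1 i = 'C(n, i)%:R * 2^-1 ^+ n :> R.
Proof.
move=> hi; rewrite /binp.
have -> : 1 - 2^-1 = 2^-1 :> R by field.
by rewrite -mulrA -exprD subnKC.
Qed.

(** With mixed parities both products contain a zero factor; with a common parity exactly one of the
    two vanishes by definition, and the parity decides the sign. *)
Lemma prod_S_diff (R : realType) n (alpha : R) k (v : {ffun 'I_k -> 'I_n.+1}) l0 :
  \prod_l S_e n alpha (v l) - \prod_l S_o n alpha (v l) =
  (alpha * 2^-1 ^+ n) ^+ k *
  (wt R n (vals v) *
    if [forall l, odd (v l) == odd (v l0)] then (-1) ^+ v l0 else 0).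
Proof.
have prodE : \prod_l (alpha * binp n 2^-1 (v l)) =
    (alpha * 2^-1 ^+ n) ^+ k * wt R n (vals v).
  have -> (c : R) : c ^+ k = \prod_(l < k) c by rewrite prodr_const card_ord.
  rewrite -big_split /=; apply: eq_bigr => l _.
  by rewrite binp_half -1?ltnS // mulrCA mulrC.
rewrite mulrA -prodE; case: ifPn => [/forallP par|/forallPn[l1 par]].
  have e (b : bool) : \prod_l (if odd (v l) == b
      then alpha * binp n 2^-1 (v l) else 0) =
    if odd (v l0) == b then \prod_l (alpha * binp n 2^-1 (v l)) else 0.
    case: ifPn => hb; last by rewrite (bigD1 l0) //= (negPf hb) mul0r.
    by apply: eq_bigr => l _; rewrite (eqP (par l)) hb.
  have := e false; have := e true.
  rewrite -signr_odd; case: (odd (v l0)) => /= h1 h2.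
    have -> : \prod_l S_o n alpha (v l) = \prod_l (alpha * binp n 2^-1 (v l)).
      by rewrite -h1; apply: eq_bigr => l _; rewrite /S_o; case: odd.
    have -> : \prod_l S_e n alpha (v l) = 0.
      by rewrite -h2; apply: eq_bigr => l _; rewrite /S_e; case: odd.
    by rewrite sub0r expr1 mulrN1.
  have -> : \prod_l S_o n alpha (v l) = 0.
    by rewrite -h1; apply: eq_bigr => l _; rewrite /S_o; case: odd.
  have -> : \prod_l S_e n alpha (v l) = \prod_l (alpha * binp n 2^-1 (v l)).
    by rewrite -h2; apply: eq_bigr => l _; rewrite /S_e; case: odd.
  by rewrite subr0 expr0 mulr1.
have l10 : l1 != l0 by apply: contraNneq par => ->.
rewrite mulr0 (bigD1 l0) //= (bigD1 l1) //= [X in _ - X](bigD1 l0) //=.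
rewrite [X in _ - _ * X](bigD1 l1) //= /S_e /S_o.
by move: par; case: (odd (v l0)); case: (odd (v l1)) => //= _;
  rewrite !(mul0r, mulr0) subr0.
Qed.

(** * Thinned letters in an algebra with a submultiplicative norm *)

Section NormedAlgebra.
Variables (R : realType) (A : algType R) (N : A -> R).
Hypothesis normD : forall a b, N (a + b) <= N a + N b.
Hypothesis normZ : forall c a, N (c *: a) <= `|c| * N a.
Hypothesis normM : forall a b, N (a * b) <= N a * N b.
Hypothesis norm1 : N 1 <= 1.

Lemma norm0_le0 : N 0 <= 0.
Proof. by have := normZ 0 0; rewrite scale0r normr0 mul0r. Qed.

Lemma normN a : N (- a) <= N a.
Proof. by rewrite -scaleN1r (le_trans (normZ _ _)) // normrN1 mul1r. Qed.

Lemma norm_ge0 a : 0 <= N a.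
Proof.
have := normD a (- a); rewrite subrr => h0.
have h00 : 0 <= N 0.
  by have := normD 0 0; rewrite addr0; lra.
by have := normN a; lra.
Qed.

Lemma norm_sum I (s : seq I) (P : pred I) (F : I -> A) :
  N (\sum_(i <- s | P i) F i) <= \sum_(i <- s | P i) N (F i).
Proof.
elim/big_ind2: _ => //; first exact: norm0_le0.
by move=> a x b y ha hb; apply: (le_trans (normD _ _)); exact: lerD.
Qed.

Lemma norm_prod I (s : seq I) (F : I -> A) :
  N (\prod_(i <- s) F i) <= \prod_(i <- s) N (F i).
Proof.
elim: s => [|i s IHs]; first by rewrite !big_nil.
rewrite !big_cons (le_trans (normM _ _)) //.
by rewrite ler_wpM2l ?norm_ge0.
Qed.

Lemma normX_le1 a k : N a <= 1 -> N (a ^+ k) <= 1.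
Proof.
move=> ha; elim: k => [|k IHk]; first by rewrite expr0.
by rewrite exprS (le_trans (normM _ _)) // mulr_ile1 ?norm_ge0.
Qed.

Lemma normM_lel a b : N a <= 1 -> N (a * b) <= N b.
Proof. by move=> ha; rewrite (le_trans (normM _ _)) // ler_piMl ?norm_ge0. Qed.

Lemma normM_ler a b : N b <= 1 -> N (a * b) <= N a.
Proof. by move=> hb; rewrite (le_trans (normM _ _)) // ler_piMr ?norm_ge0. Qed.

Lemma normZ_nneg c a : 0 <= c -> N (c *: a) <= c * N a.
Proof. by move=> c0; rewrite -{2}(ger0_norm c0). Qed.

Variables (T : A) (d : R).
Hypothesis normT : N T <= 1.
Hypotheses (d_ge0 : 0 <= d) (d_le1 : d <= 1).

Definition thinned : A := d *: 1 + (1 - d) *: T.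
Local Notation Z := thinned.

Let e_ge0 : 0 <= 1 - d. Proof. by rewrite subr_ge0. Qed.

Lemma norm_thinned : N Z <= 1.
Proof.
have h1 := normZ_nneg 1 d_ge0; have h2 := normZ_nneg T e_ge0.
have h3 : d * N 1 <= d * 1 by rewrite ler_wpM2l.
have h4 : (1 - d) * N T <= (1 - d) * 1 by rewrite ler_wpM2l.
by apply: (le_trans (normD _ _)); lra.
Qed.

Lemma mulX_thinned k : T ^+ k * Z = d *: T ^+ k + (1 - d) *: T ^+ k.+1.
Proof. by rewrite mulrDr -!scalerAr mulr1 -exprSr. Qed.

(** [(1 - d) ^+ h] is the probability that none of [h] letters is deleted; the remainder carries the
    complementary mass. *)
Lemma thinnedX_main h :
  N (Z ^+ h - (1 - d) ^+ h *: T ^+ h) <= 1 - (1 - d) ^+ h.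
Proof.
elim: h => [|h IHh]; first by rewrite !expr0 scale1r !subrr norm0_le0.
set t := (1 - d) ^+ h in IHh *.
have -> : Z ^+ h.+1 - (1 - d) ^+ h.+1 *: T ^+ h.+1 =
    (Z ^+ h - t *: T ^+ h) * Z + (t * d) *: T ^+ h.
  rewrite mulrBl -exprSr -scalerAl mulX_thinned scalerDr !scalerA opprD -exprSr.
  by rewrite addrA addrAC subrK.
have t0 : 0 <= t by rewrite exprn_ge0.
have h1 := normM_ler (Z ^+ h - t *: T ^+ h) norm_thinned.
have h2 := normZ_nneg (T ^+ h) (mulr_ge0 t0 d_ge0).
have h3 : t * d * N (T ^+ h) <= t * d by rewrite ler_piMr ?mulr_ge0 ?normX_le1.
apply: (le_trans (normD _ _)); rewrite exprSr -/t; lra.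
Qed.

(* [Z ^+ h.+1 = t T ^+ h.+1 + s T ^+ h + rest], the three parts having total
   mass 1: no deletion, one deletion, or more among [h.+1] letters. *)
Lemma thinnedX_second h (s := h.+1%:R * d * (1 - d) ^+ h) :
  N (Z ^+ h.+1 - s *: T ^+ h) <= 1 - s.
Proof.
suff H : N (Z ^+ h.+1 - (1 - d) ^+ h.+1 *: T ^+ h.+1 - s *: T ^+ h)
    <= 1 - (1 - d) ^+ h.+1 - s.
  set t := (1 - d) ^+ h.+1 in H *.
  have t0 : 0 <= t by rewrite exprn_ge0.
  have h2 := normZ_nneg (T ^+ h.+1) t0.
  have h3 : t * N (T ^+ h.+1) <= t by rewrite ler_piMr ?normX_le1.
  have -> : Z ^+ h.+1 - s *: T ^+ h =
     (Z ^+ h.+1 - t *: T ^+ h.+1 - s *: T ^+ h) + t *: T ^+ h.+1.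
    by rewrite addrAC subrK.
  by apply: (le_trans (normD _ _)); lra.
rewrite {}/s; elim: h => [|h IHh] /=.
  rewrite !expr1 expr0 mulr1 mul1r /Z addrK subrr.
  by apply: le_trans norm0_le0 _; lra.
set t := (1 - d) ^+ h.+1 in IHh *; set s := _ * _ * _ in IHh.
set b := _ - _ - _ in IHh.
have e1 : (1 - d) ^+ h.+2 = t * (1 - d) by rewrite exprSr.
(* One deletion among [h.+2] letters: either the last letter is the deleted one, or it survives and
   the deletion came earlier. *)
have e2 : h.+2%:R * d * t = t * d + s * (1 - d).
  by rewrite /s /t exprSr -(addn1 h.+1) natrD; ring.
rewrite e1 e2.
have -> : Z ^+ h.+2 - (t * (1 - d)) *: T ^+ h.+2
      - (t * d + s * (1 - d)) *: T ^+ h.+1 = b * Z + (s * d) *: T ^+ h.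
  rewrite /b 2!mulrBl -exprSr -!scalerAl !mulX_thinned !scalerDr !scalerA.
  rewrite scalerDl !opprD !addrA (addrAC _ (- (_ *: T ^+ h.+1)) (_ *: T ^+ h)).
  by rewrite subrK (addrAC _ (- (_ *: T ^+ h.+2)) (- (_ *: T ^+ h.+1))) -!exprSr.
have s0 : 0 <= s by rewrite !mulr_ge0 ?exprn_ge0.
have h1 := normM_ler b norm_thinned.
have h2 := normZ_nneg (T ^+ h) (mulr_ge0 s0 d_ge0).
have h3 : s * d * N (T ^+ h) <= s * d.
  by rewrite ler_piMr ?(mulr_ge0 s0 d_ge0) // normX_le1.
by apply: (le_trans (normD _ _)); lra.
Qed.

(* Moving one of [2 h + 1] thinned zeros from one side of [a] to the other is
   invisible on the event where exactly one of the [h.+1] zeros and none of the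
   [h] others is deleted; for [h] of order [1 / d] this has probability at
   least [1 / 8]. *)
Lemma norm_shift_le h a x y : 0 <= x -> 0 <= y ->
  4 * h%:R * d <= 1 -> 1 <= 4 * h.+1%:R * d ->
  N (x *: (Z ^+ h * a * Z ^+ h.+1) - y *: (Z ^+ h.+1 * a * Z ^+ h)) <=
    (x + y - Num.min x y / 4) * N a.
Proof.
move=> x0 y0 hd1 hd2.
set t := (1 - d) ^+ h; set s := h.+1%:R * d * t.
set c := T ^+ h * a * T ^+ h.
have t0 : 0 <= t by rewrite exprn_ge0.
have s0 : 0 <= s by rewrite !mulr_ge0.
have nb := norm_ge0 a.
have ZX k : N (Z ^+ k) <= 1 by apply: normX_le1; exact: norm_thinned.
have TX k : N (T ^+ k) <= 1 by exact: normX_le1.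
have hE := thinnedX_main h; rewrite -/t in hE.
have hE' := thinnedX_second h; rewrite /= -/t -/s in hE'.
have part1 : N (Z ^+ h * a * Z ^+ h.+1 - (t * s) *: c) <= (1 - t * s) * N a.
  have -> : Z ^+ h * a * Z ^+ h.+1 - (t * s) *: c =
     (Z ^+ h - t *: T ^+ h) * (a * Z ^+ h.+1) +
     t *: (T ^+ h * a * (Z ^+ h.+1 - s *: T ^+ h)).
    rewrite mulrBl mulrBr scalerBr -!scalerAl -!scalerAr scalerA !mulrA addrA.
    by rewrite subrK.
  apply: (le_trans (normD _ _)).
  have h1 : N ((Z ^+ h - t *: T ^+ h) * (a * Z ^+ h.+1)) <= (1 - t) * N a.
    by apply: (le_trans (normM _ _)); apply: ler_pM;
      rewrite ?norm_ge0 ?normM_ler.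
  have h2 : N (T ^+ h * a * (Z ^+ h.+1 - s *: T ^+ h)) <= N a * (1 - s).
    by apply: (le_trans (normM _ _)); apply: ler_pM;
      rewrite ?norm_ge0 ?normM_lel.
  have h3 := normZ_nneg (T ^+ h * a * (Z ^+ h.+1 - s *: T ^+ h)) t0.
  have h4 := ler_wpM2l t0 h2.
  by apply: (le_trans (lerD h1 (le_trans h3 h4))); nra.
have part2 : N (Z ^+ h.+1 * a * Z ^+ h - (t * s) *: c) <= (1 - t * s) * N a.
  have -> : Z ^+ h.+1 * a * Z ^+ h - (t * s) *: c =
     Z ^+ h.+1 * a * (Z ^+ h - t *: T ^+ h) +
     t *: ((Z ^+ h.+1 - s *: T ^+ h) * (a * T ^+ h)).
    rewrite mulrBr mulrBl scalerBr -!scalerAl -!scalerAr scalerA !mulrA addrA.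
    by rewrite subrK.
  apply: (le_trans (normD _ _)).
  have h1 : N (Z ^+ h.+1 * a * (Z ^+ h - t *: T ^+ h)) <= N a * (1 - t).
    by apply: (le_trans (normM _ _)); apply: ler_pM;
      rewrite ?norm_ge0 ?normM_lel.
  have h2 : N ((Z ^+ h.+1 - s *: T ^+ h) * (a * T ^+ h)) <= (1 - s) * N a.
    by apply: (le_trans (normM _ _)); apply: ler_pM;
      rewrite ?norm_ge0 ?normM_ler.
  have h3 := normZ_nneg ((Z ^+ h.+1 - s *: T ^+ h) * (a * T ^+ h)) t0.
  have h4 := ler_wpM2l t0 h2.
  by apply: (le_trans (lerD h1 (le_trans h3 h4))); nra.
have nc : N c <= N a.
  by rewrite /c (le_trans (normM_ler _ (TX _))) // normM_lel.
(* [t * s] is [h.+1 d] times [(1 - d) ^ (2 h)]: the first factor is at least 1/4, the second at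
   least [1 - 2 h d >= 1 / 2]. *)
have ts8 : 1 / 8 <= t * s.
  have d01 : 0 <= d <= 1 by rewrite d_ge0.
  have b1 := bernoulli_le (h + h) d01; rewrite natrD exprD -/t in b1.
  have -> : t * s = h.+1%:R * d * (t * t) by rewrite /s; ring.
  have u1 : 1 / 4 <= h.+1%:R * d by lra.
  have u2 : 1 / 2 <= t * t by lra.
  by have := ler_pM _ _ u1 u2; lra.
(* The common part [c] now has coefficient [(x - y) t s], so the bound drops by [2 t s] times the
   minimum of [x] and [y], at least a quarter of it. *)
have -> : x *: (Z ^+ h * a * Z ^+ h.+1) - y *: (Z ^+ h.+1 * a * Z ^+ h) =
  x *: (Z ^+ h * a * Z ^+ h.+1 - (t * s) *: c) +
  ((x - y) * (t * s)) *: c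
  - y *: (Z ^+ h.+1 * a * Z ^+ h - (t * s) *: c).
  rewrite !scalerBr !scalerA mulrBl scalerBl addrA subrK opprD opprK addrA.
  by rewrite [RHS]addrAC subrK.
have q1 := normZ_nneg (Z ^+ h * a * Z ^+ h.+1 - (t * s) *: c) x0.
have q2 := normZ_nneg (Z ^+ h.+1 * a * Z ^+ h - (t * s) *: c) y0.
have q3 := normZ ((x - y) * (t * s)) c.
have ts0 : 0 <= t * s by rewrite mulr_ge0.
rewrite normrM (ger0_norm ts0) in q3.
have q4 : `|x - y| * (t * s) * N c <= `|x - y| * (t * s) * N a.
  by rewrite ler_wpM2l ?mulr_ge0.
have p1 := ler_wpM2l x0 part1; have p2 := ler_wpM2l y0 part2.
apply: (le_trans (normD _ _)).
have q5 := normN (y *: (Z ^+ h.+1 * a * Z ^+ h - (t * s) *: c)).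
have q6 := normD (x *: (Z ^+ h * a * Z ^+ h.+1 - (t * s) *: c))
  (((x - y) * (t * s)) *: c).
have m0 : 0 <= Num.min x y by rewrite le_min x0.
have key : `|x - y| = x + y - 2 * Num.min x y.
  by have [xy|/ltW xy] := leP x y; [rewrite ler0_norm|rewrite ger0_norm]; lra.
rewrite key in q3 q4.
have fin : 0 <= (t * s - 1 / 8) * (Num.min x y * N a).
  by rewrite mulr_ge0 ?subr_ge0 ?mulr_ge0.
set n1 := N (x *: _) in q1 q6 *; set n2 := N (y *: _) in q2 q5 *.
set n3 := N (_ *: c) in q3 q6; set n4 := N (x *: _ + _) in q6 *.
set n5 := N (- _) in q5 *.
have e1 : n4 + n5 <= x * ((1 - t * s) * N a) +
  (x + y - 2 * Num.min x y) * (t * s) * N a + y * ((1 - t * s) * N a) by lra.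
by apply: (le_trans e1); nra.
Qed.


(** * Blocks of coordinates and their contraction *)

Section Blocks.
Variables (I : finType) (l0 l1 : I).
Implicit Types (Y : (I -> nat) -> A) (i : I -> nat).

Definition shift_invariant Y := forall i, Y (fun l => (i l).+1) = Y i.

(* The contribution of [r] coordinates of the binomial weights to the signed sum
   over the positions [i l] of the marked letters: [Y] sees only the gaps, and
   the shared shift is turned into thinned zeros on both sides. *)
Definition blk r Y i : A :=
  wsum r (fun v => (-1) ^+ v l0 *:
    (Z ^+ v l0 * Y (fun l => i l + v l)%N * Z ^+ (r - v l1))).

(** Positions add by [wsum_add], signs multiply, and the thinned zeros of the outer block wrap those
    of the inner one. *)
Lemma blk_add r s Y i : blk r (blk s Y) i = blk (r + s) Y i.
Proof.
rewrite {3}/blk -wsum_add {1}/blk /wsum; apply: eq_bigr => v _; congr (_ *: _).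
rewrite /blk /wsum mulr_sumr mulr_suml scaler_sumr; apply: eq_bigr => u _.
rewrite -!scalerAr -!scalerAl !scalerA /vals exprD; congr (_ *: _); first by ring.
have vr := ltn_ord (v l1); have us := ltn_ord (u l1).
have -> : (r + s - (v l1 + u l1) = (s - u l1) + (r - v l1))%N by lia.
rewrite [Z ^+ (v l0 + _)]exprD [Z ^+ (s - _ + _)]exprD !mulrA.
congr (_ * Y _ * _ * _).
by apply: funext => l; rewrite addnA.
Qed.

Lemma blk_shift_invariant r Y : shift_invariant Y -> shift_invariant (blk r Y).
Proof.
move=> hY i; apply: eq_bigr => v _; congr (_ *: (_ *: (_ * _ * _))).
exact: (hY (fun l => i l + vals v l)%N).
Qed.

Lemma norm_sign m a : N ((-1) ^+ m *: a) <= N a.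
Proof. by rewrite (le_trans (normZ _ _)) // normrX normrN1 expr1n mul1r. Qed.

Lemma normX_thinned m : N (Z ^+ m) <= 1.
Proof. exact: normX_le1 norm_thinned. Qed.

Lemma norm_sandwich m m' a : N (Z ^+ m * a * Z ^+ m') <= N a.
Proof.
by rewrite (le_trans (normM_ler _ (normX_thinned _))) ?normM_lel ?normX_thinned.
Qed.

Lemma norm_blk r Y i M : (forall i, N (Y i) <= M) ->
  N (blk r Y i) <= (2 ^+ r) ^+ #|I| * M.
Proof.
move=> hY; rewrite /blk /wsum -sum_wt mulr_suml.
apply: (le_trans (norm_sum _ _ _)); apply: ler_sum => v _.
rewrite (le_trans (normZ_nneg _ (wt_ge0 _ _ _))) // ler_wpM2l ?wt_ge0 //.
by rewrite (le_trans (norm_sign _ _)) // (le_trans (norm_sandwich _ _ _)).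
Qed.

Section Contraction.
Variable h : nat.
Hypotheses (hd1 : 4 * h%:R * d <= 1) (hd2 : 1 <= 4 * h.+1%:R * d).

(** The two terms of a pair share the outer factors [Z ^+ p] and [Z ^+ q]; what is left has the
    shape treated by [norm_shift_le]. *)
Lemma central_split r j j' : central h r j -> central h r j' ->
  exists p q, [/\ j.-1 = p + h, j = p + h.+1, r - j'.-1 = h.+1 + q
    & r - j' = h + q]%N.
Proof.
rewrite /central => cj cj'; clear -cj cj'.
by exists (j.-1 - h)%N, (r - j' - h)%N; split; lia.
Qed.

Lemma norm_pair_le r Y i (v : {ffun I -> 'I_r.+2}) : shift_invariant Y ->
  N (wtpred R r (vals v) *: ((-1) ^+ (v l0).-1 *:
      (Z ^+ (v l0).-1 * Y (fun l => i l + (v l).-1)%N * Z ^+ (r - (v l1).-1))) +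
     wt R r (vals v) *: ((-1) ^+ v l0 *:
      (Z ^+ v l0 * Y (fun l => i l + v l)%N * Z ^+ (r - v l1))))
  <= wtpred R r (vals v) * N (Y (fun l => i l + (v l).-1)%N) +
     wt R r (vals v) * N (Y (fun l => i l + v l)%N).
Proof.
move=> hY; apply: (le_trans (normD _ _)); apply: lerD;
  rewrite (le_trans (normZ_nneg _ _)) ?wt_ge0 ?wtpred_ge0 //
    ler_wpM2l ?wt_ge0 ?wtpred_ge0 //;
  by rewrite (le_trans (norm_sign _ _)) // (le_trans (norm_sandwich _ _ _)).
Qed.

Lemma norm_central_pair_le r Y i (v : {ffun I -> 'I_r.+2}) M :
  shift_invariant Y -> (forall i, N (Y i) <= M) ->
  (forall l, central h r (v l)) ->
  N (wtpred R r (vals v) *: ((-1) ^+ (v l0).-1 *: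
      (Z ^+ (v l0).-1 * Y (fun l => i l + (v l).-1)%N * Z ^+ (r - (v l1).-1))) +
     wt R r (vals v) *: ((-1) ^+ v l0 *:
      (Z ^+ v l0 * Y (fun l => i l + v l)%N * Z ^+ (r - v l1))))
  <= (wtpred R r (vals v) + wt R r (vals v) -
      Num.min (wtpred R r (vals v)) (wt R r (vals v)) / 4) * M.
Proof.
move=> hY hM hv; set x := wtpred R r (vals v); set y := wt R r (vals v).
have x0 : 0 <= x by exact: wtpred_ge0.
have y0 : 0 <= y by exact: wt_ge0.
pose a := Y (fun l => i l + (v l).-1)%N.
have vpos l : (0 < v l)%N by have /andP[] := hv l; case: (nat_of_ord _).
have -> : Y (fun l => i l + v l)%N = a.
  rewrite -[RHS]hY; congr Y; apply: funext => l.
  by rewrite -addnS prednK.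
have [p [q [-> -> -> ->]]] := central_split (hv l0) (hv l1).
have -> : x *: ((-1) ^+ (p + h) *: (Z ^+ (p + h) * a * Z ^+ (h.+1 + q))) +
    y *: ((-1) ^+ (p + h.+1) *: (Z ^+ (p + h.+1) * a * Z ^+ (h + q))) =
    (-1) ^+ (p + h) *: (Z ^+ p *
      (x *: (Z ^+ h * a * Z ^+ h.+1) - y *: (Z ^+ h.+1 * a * Z ^+ h)) * Z ^+ q).
  rewrite mulrBr mulrBl scalerBr -!scalerAr -!scalerAl !scalerA.
  rewrite [x * _]mulrC [(-1) ^+ (p + h) * y]mulrC -scaleNr.
  rewrite (exprD Z p h) (exprD Z p h.+1) (exprD Z h q) (exprD Z h.+1 q) !mulrA.
  by congr (_ + _ *: _); rewrite addnS exprS mulN1r mulrN.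
apply: (le_trans (norm_sign _ _)); apply: (le_trans (norm_sandwich _ _ _)).
apply: (le_trans (norm_shift_le a x0 y0 hd1 hd2)).
apply: ler_wpM2l (hM _).
have : Num.min x y <= x by rewrite ge_min lexx.
by lra.
Qed.

(* Averaging the sum over [v] with its translate pairs each [v] with its
   diagonal neighbour, and the two terms of a pair have opposite signs. *)
Lemma norm_blk_contract r Y i M : (4 * h.+1 <= r.+1)%N -> (20 * #|I| <= r.+1)%N ->
  shift_invariant Y -> (forall i, N (Y i) <= M) ->
  N (blk r Y i) <= (2 ^+ r) ^+ #|I| * (31 / 32 * M).
Proof.
move=> hr kr hY hM; set W := (2 ^+ r) ^+ #|I|.
have M0 : 0 <= M by exact: le_trans (norm_ge0 _) (hM i).
set F := fun v : I -> nat => (-1) ^+ v l0 *: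
    (Z ^+ v l0 * Y (fun l => i l + v l)%N * Z ^+ (r - v l1)).
have -> : blk r Y i = 2^-1 *: (\sum_(v : {ffun I -> 'I_r.+2})
    (wtpred R r (vals v) *: F (fun l => (v l).-1) +
     wt R r (vals v) *: F (vals v))).
  rewrite big_split /= -wsum_pred -wsum_wide -/(blk r Y i).
  by rewrite -[blk r Y i]scale1r -scalerDl scalerA mulVf.
have half0 : 0 <= 2^-1 :> R by rewrite invr_ge0.
apply: (le_trans (normZ_nneg _ half0)).
pose mn (v : {ffun I -> 'I_r.+2}) := Num.min (wtpred R r (vals v)) (wt R r (vals v)).
have : N (\sum_(v : {ffun I -> 'I_r.+2})
    (wtpred R r (vals v) *: F (fun l => (v l).-1) + wt R r (vals v) *: F (vals v)))
  <= \sum_(v : {ffun I -> 'I_r.+2}) (wtpred R r (vals v) + wt R r (vals v) -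
        (if [forall l, central h r (v l)] then mn v else 0) / 4) * M.
  apply: (le_trans (norm_sum _ _ _)); apply: ler_sum => v _.
  case: ifP => [/forallP hv|_]; first exact: norm_central_pair_le.
  rewrite mul0r subr0 mulrDl.
  apply: (le_trans (norm_pair_le _ _ hY)).
  by rewrite lerD // ler_wpM2l ?wt_ge0 ?wtpred_ge0.
set n1 := N _; rewrite -mulr_suml big_split big_split /= sumrN -mulr_suml.
rewrite -big_mkcond /= sum_wt_wide sum_wtpred -/W.
(* The constant is [1 - 1/2 * 1/4 * 1/4]: the averaging, the gain per pair, and the overlap
   [W / 4]. *)
have := sum_min_wt_ge R hr kr; rewrite -/W /mn.
set S := \sum_(v | _) _ => hS hn.
have := ler_wpM2r M0 hS; nra.
Qed.

Lemma norm_blk_iter r Y i M B : (4 * h.+1 <= r.+1)%N -> (20 * #|I| <= r.+1)%N ->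
  shift_invariant Y -> (forall i, N (Y i) <= M) ->
  N (blk (r * B) Y i) <= (2 ^+ (r * B)) ^+ #|I| * ((31 / 32) ^+ B * M).
Proof.
move=> hr kr hY hM; elim: B i => [|B IHB] i.
  by rewrite muln0 expr0 mul1r; exact: norm_blk.
rewrite mulnS -blk_add exprD exprMn -mulrA exprS.
have -> : (2 ^+ (r * B)) ^+ #|I| * (31 / 32 * (31 / 32) ^+ B * M) =
   31 / 32 * ((2 ^+ (r * B)) ^+ #|I| * ((31 / 32) ^+ B * M)) by ring.
by apply: norm_blk_contract => //; exact: blk_shift_invariant.
Qed.

Lemma norm_blk_le r n Y i M : (4 * h.+1 <= r.+1)%N -> (20 * #|I| <= r.+1)%N ->
  shift_invariant Y -> (forall i, N (Y i) <= M) ->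
  N (blk n Y i) <= (2 ^+ n) ^+ #|I| * ((31 / 32) ^+ (n %/ r) * M).
Proof.
move=> hr kr hY hM.
have e : n = (n %% r + r * (n %/ r))%N by rewrite addnC mulnC -divn_eq.
(* The [n %% r] leftover coordinates form an outer block, estimated without cancellation. *)
rewrite {1 2}e -blk_add exprD exprMn -mulrA.
by apply: norm_blk => j; exact: norm_blk_iter.
Qed.

End Contraction.
End Blocks.

(** * Expansion into marked words *)

Variable T' : A.
Hypothesis normT' : N T' <= 1.

(** A thinned one minus a thinned zero; the deletion terms [d *: 1] cancel. *)
Definition mark : A := (1 - d) *: (T' - T).
Local Notation U := mark.

Lemma norm_mark : N U <= 2.
Proof.
apply: (le_trans (normZ_nneg _ e_ge0)).
have : N (T' - T) <= 2.
  by apply: (le_trans (normD _ _)); apply: (lerD normT' (le_trans (normN T) normT)).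
by move=> h; apply: (le_trans (ler_wpM2l e_ge0 h)); have := d_ge0; lra.
Qed.

Lemma prod_markE m (p : nat -> R) :
  \prod_(i < m) (Z + p i *: U) =
  \sum_(k < m.+1) (k`!%:R^-1 : R) *:
    \sum_(v : {ffun 'I_k -> 'I_m} | injectiveb v)
      (\prod_l p (v l)) *:
      \prod_(i < m) (if [exists l, v l == i :> nat] then U else Z).
Proof.
under eq_bigr do rewrite addrC.
rewrite bigA_distr (eq_bigl xpredT) // sum_set_inj; apply: eq_bigr => k _; congr (_ *: _).
apply: eq_bigr => v /injectiveP vi.
have -> : \prod_l p (v l) =
    \prod_(i < m) (if i \in v @: [set: 'I_k] then p i else 1).
  rewrite -big_mkcond big_imset /=; last by move=> ? ? _ _; exact: vi.
  by apply: eq_bigl => l; rewrite inE.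
rewrite -scaler_prod; apply: eq_bigr => i _.
have -> : [exists l, v l == i :> nat] = (i \in v @: [set: 'I_k]).
  apply/existsP/imsetP => [[l /eqP e]|[l _ ->]]; last by exists l.
  by exists l => //; exact: val_inj.
by case: ifP => _ //; rewrite scale1r.
Qed.

Section MarkedWord.
Variables (I : finType) (l0 l1 : I).
Implicit Types i : I -> nat.

Definition letter i j : A := if [exists l, i l == j] then U else Z.

(* Summing over all choices of the leftmost and rightmost marks [l0] and [l1],
   instead of sorting the marks, costs only a factor [#|I| ^+ 2]. *)
Definition extremal i :=
  [&& injectiveb i, [forall l, i l0 <= i l <= i l1]%N &
      [forall l, odd (i l) == odd (i l0)]].

(** The value 0 off [extremal] absorbs injectivity, the common parity and the choice of outermost
    marks, which leaves the sum over positions unrestricted. *)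
Definition core i : A :=
  if extremal i then \prod_(i l0 <= j < (i l1).+1) letter i j else 0.

Lemma core_shift_invariant : shift_invariant core.
Proof.
move=> i; rewrite /core.
have -> : extremal (fun l => (i l).+1) = extremal i.
  congr [&& _, _ & _].
  - apply/injectiveP/injectiveP => h x y e; apply: h; first by rewrite e.
    by case: e.
  - by apply: eq_forallb => l /=; rewrite (inj_eq negb_inj).
case: ifP => // _; rewrite big_add1 /=; apply: eq_bigr => j _.
by congr (if _ then _ else _); apply: eq_existsb => l; rewrite eqSS.
Qed.

(** At most [#|I|] letters are marks, of norm at most 2; the thinned zeros have norm at most 1. *)
Lemma norm_core i : N (core i) <= 2 ^+ #|I|.
Proof.
rewrite /core; case: ifP => _; last first.
  by rewrite (le_trans norm0_le0) // exprn_ge0.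
set s := index_iota _ _; pose P j := [exists l, i l == j].
apply: (@le_trans _ _ (\prod_(j <- s) (if P j then 2 else 1 : R))).
  apply: (le_trans (norm_prod _ _)); apply: ler_prod => j _.
  rewrite norm_ge0 /letter -/(P j).
  by case: ifP => _; [exact: norm_mark | exact: norm_thinned].
rewrite -big_mkcond big_const_seq iter_mulr_1 ler_weXn2l ?ler1n //.
rewrite -size_filter cardE -(size_map i); apply: uniq_leq_size.
  by rewrite filter_uniq // iota_uniq.
move=> j; rewrite mem_filter => /andP[/existsP[l /eqP <-] _].
by apply: map_f; rewrite mem_enum.
Qed.

Lemma wordE n i : (i l1 <= n)%N -> (forall l, i l0 <= i l <= i l1)%N ->
  \prod_(j < n.+1) letter i j =
  Z ^+ i l0 * \prod_(i l0 <= j < (i l1).+1) letter i j * Z ^+ (n - i l1).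
Proof.
move=> in1 h; have /andP[_ i01] := h l0.
rewrite -(big_mkord xpredT (letter i)).
rewrite (big_cat_nat (n := i l0)) //=; last exact: leq_trans i01 (leqW in1).
rewrite (big_cat_nat (n := (i l1).+1) (m := i l0)) //=; last exact: leqW i01.
rewrite mulrA; congr (_ * _ * _).
  rewrite -[X in Z ^+ X]subn0 -prodr_const_nat; apply: eq_big_nat => j /andP[_ hj].
  rewrite /letter; case: ifP => // /existsP[l /eqP e].
  by have /andP[] := h l; rewrite e leqNgt hj.
rewrite -subSS -prodr_const_nat; apply: eq_big_nat => j /andP[hj _].
rewrite /letter; case: ifP => // /existsP[l /eqP e].
by have /andP[_] := h l; rewrite e leqNgt hj.
Qed.

End MarkedWord.
(** An injective [v] attains its minimum and its maximum only once, so a single pair of indices can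
    contribute. *)
Lemma sum_extremal n k (v : {ffun 'I_k -> 'I_n.+1}) :
  injective v -> (0 < k)%N ->
  exists l0 l1 : 'I_k, (forall l, v l0 <= v l <= v l1)%N /\
    forall f : 'I_k -> 'I_k -> A,
      (forall m0 m1, ~~ extremal m0 m1 (vals v) -> f m0 m1 = 0) ->
      \sum_m0 \sum_m1 f m0 m1 = f l0 l1.
Proof.
move=> vi k0; pose o := Ordinal k0.
have [l0 _ hl0] := @arg_minnP _ o xpredT (fun l => v l : nat) isT.
have [l1 _ hl1] := @arg_maxnP _ o xpredT (fun l => v l : nat) isT.
exists l0, l1; split=> [l|f f0]; first by rewrite hl0 //=; exact: hl1.
have vi' (l m : 'I_k) : v l = v m :> nat -> l = m by move=> e; apply/vi/val_inj.
rewrite (bigD1 l0) //= (bigD1 l1) //= !big1 ?addr0 //.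
  move=> m0 m0l0; rewrite big1 // => m1 _; apply: f0.
  apply: contra m0l0 => /and3P[_ /forallP/(_ l0)/andP[h _] _].
  by apply/eqP/vi'/eqP; rewrite eqn_leq hl0 // andbT.
move=> m1 m1l1; apply: f0; apply: contra m1l1.
move=> /and3P[_ /forallP/(_ l1)/andP[_ h] _].
by apply/eqP/vi'/eqP; rewrite eqn_leq h andbT; exact: hl1.
Qed.

(** For fixed [l0] and [l1], summing the right side over all [v] gives a [blk] at offset 0. *)
Lemma core_sumE n (alpha : R) k (v : {ffun 'I_k -> 'I_n.+1}) : (0 < k)%N ->
  (if injectiveb v then
    (\prod_l S_e n alpha (v l) - \prod_l S_o n alpha (v l)) *:
      \prod_(i < n.+1) (if [exists l, v l == i :> nat] then U else Z)
   else 0) =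
  (alpha * 2^-1 ^+ n) ^+ k *: \sum_l0 \sum_l1 wt R n (vals v) *:
    ((-1) ^+ v l0 *: (Z ^+ v l0 * core l0 l1 (vals v) * Z ^+ (n - v l1))).
Proof.
move=> k0; have injE : injectiveb (vals v) = injectiveb v.
  by apply/injectiveP/injectiveP => h x y e; apply: h => //; [congr nat_of_ord|exact: val_inj].
case: ifPn => vi; last first.
  rewrite big1 ?scaler0 // => l0 _; rewrite big1 // => l1 _.
  by rewrite /core /extremal injE (negPf vi) mulr0 mul0r !scaler0.
have [l0 [l1 [hl ->]]] := sum_extremal (elimT (injectiveP _) vi) k0; last first.
  by move=> m0 m1 /negPf e; rewrite /core e mulr0 mul0r !scaler0.
rewrite (prod_S_diff _ _ l0) -!scalerA; congr (_ *: (_ *: _)).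
rewrite /core /extremal injE vi /=.
have -> : [forall l, vals v l0 <= vals v l <= vals v l1]%N by exact/forallP.
case: ifPn => _; last by rewrite scale0r mulr0 mul0r scaler0.
congr (_ *: _); rewrite -(wordE _ hl) //.
by rewrite /vals -ltnS.
Qed.

Lemma norm_diff_le (h r n : nat) (alpha : R) : 0 <= alpha ->
  4 * h%:R * d <= 1 -> 1 <= 4 * h.+1%:R * d -> (4 * h.+1 <= r.+1)%N ->
  N (\prod_(i < n.+1) (Z + S_e n alpha i *: U) -
     \prod_(i < n.+1) (Z + S_o n alpha i *: U)) <=
  \sum_(k < n.+2) k`!%:R^-1 * (k%:R ^+ 2 * (2 * alpha) ^+ k *
     (if (20 * k <= r.+1)%N then (31 / 32) ^+ (n %/ r) else 1)).
Proof.
move=> alpha0 hd1 hd2 hr.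
rewrite !prod_markE -sumrB; apply: (le_trans (norm_sum _ _ _)).
apply: ler_sum => k _; rewrite -scalerBr -sumrB.
have kf : 0 <= k`!%:R^-1 :> R by rewrite invr_ge0.
apply: (le_trans (normZ_nneg _ kf)); rewrite ler_wpM2l //.
under eq_bigr do rewrite -scalerBl.
(* Without marks the two products coincide; with marks, outermost ones exist. *)
have [k0|k0] := posnP k.
  rewrite big1 => [|v _].
    by rewrite (le_trans norm0_le0) // k0 expr0n mul0r mul0r.
  have noI (l : 'I_k) : False by case: l => l /=; rewrite k0.
  have e (F : 'I_k -> R) : \prod_l F l = 1.
    by apply: big1 => l; case: (noI l).
  by rewrite !e subrr scale0r.
rewrite big_mkcond /=; under eq_bigr do rewrite (core_sumE _ _ k0).
rewrite -scaler_sumr.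
have -> : \sum_(v : {ffun 'I_k -> 'I_n.+1}) \sum_l0 \sum_l1 wt R n (vals v) *:
    ((-1) ^+ v l0 *: (Z ^+ v l0 * core l0 l1 (vals v) * Z ^+ (n - v l1))) =
    \sum_(l0 < k) \sum_(l1 < k) blk l0 l1 n (core l0 l1) (fun=> 0%N).
  rewrite exchange_big /=; apply: eq_bigr => l0 _.
  by rewrite exchange_big.
set g := if _ then _ else _.
have bnd (l0 l1 : 'I_k) : N (blk l0 l1 n (core l0 l1) (fun=> 0%N)) <=
    (2 ^+ n) ^+ k * (g * 2 ^+ k).
  have nc i : N (core l0 l1 i) <= 2 ^+ k by have := norm_core l0 l1 i; rewrite card_ord.
  rewrite /g; case: ifP => hk.
    have kr : (20 * #|'I_k| <= r.+1)%N by rewrite card_ord.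
    have := norm_blk_le l0 l1 hd1 hd2 n (fun=> 0%N) hr kr
      (@core_shift_invariant _ l0 l1) nc.
    by rewrite card_ord.
  by have := norm_blk l0 l1 n (fun=> 0%N) nc; rewrite card_ord mul1r.
have a0 : 0 <= (alpha * 2^-1 ^+ n) ^+ k.
  by rewrite exprn_ge0 // mulr_ge0 // exprn_ge0 // invr_ge0.
apply: (le_trans (normZ_nneg _ a0)).
(* The choices of [l0] and [l1] give [k ^ 2]; the mass [(2 ^+ n) ^+ k] cancels the normalisation of
   the weights. *)
have : N (\sum_(l0 < k) \sum_(l1 < k) blk l0 l1 n (core l0 l1) (fun=> 0%N)) <=
    \sum_(l0 < k) \sum_(l1 < k) (2 ^+ n) ^+ k * (g * 2 ^+ k).
  apply: (le_trans (norm_sum _ _ _)); apply: ler_sum => l0 _.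
  by apply: (le_trans (norm_sum _ _ _)); apply: ler_sum => l1 _.
rewrite !sumr_const !card_ord -mulrnA -[X in _ <= X]mulr_natl => hN.
apply: (le_trans (ler_wpM2l a0 hN)); rewrite le_eqVlt; apply/orP; left; apply/eqP.
rewrite natrM !exprMn.
have e : (2^-1 ^+ n) ^+ k * (2 ^+ n) ^+ k = 1 :> R.
  by rewrite -exprMn -exprMn mulVf ?expr1n.
transitivity ((2^-1 ^+ n) ^+ k * (2 ^+ n) ^+ k *
  (k%:R ^+ 2 * (2 ^+ k * alpha ^+ k) * g)); first by ring.
by rewrite e mul1r.
Qed.

End NormedAlgebra.

(** * Matrix model of traces *)

Section WordMatrices.
Variables (R : realType) (n : nat).

(** Dependent pairs match the double sum over lengths and tuples in [trace_tv]. *)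
Definition word := {m : 'I_n.+2 & m.-tuple bool}.
Definition wseq (w : word) : seq bool := tval (tagged w).

Lemma wseq_inj : injective wseq.
Proof.
move=> [m y] [m' y']; rewrite /wseq /= => e.
have em : m = m' by apply: val_inj; have := congr1 size e; rewrite !size_tuple.
by case: m' / em y' e => y' /val_inj ->.
Qed.

Definition word_of (s : seq bool) : word :=
  let m : 'I_n.+2 := inord (size s) in
  Tagged (fun m : 'I_n.+2 => m.-tuple bool) (insubd (nseq_tuple m false) s).

Lemma word_ofK (s : seq bool) : (size s <= n.+1)%N -> wseq (word_of s) = s.
Proof. by move=> hs; rewrite /wseq /= val_insubd inordK ?eqxx. Qed.

(** A dimension of successor form gives square matrices their ring structure. *)
Let wordsE : #|{: word}|.-1.+1 = #|{: word}|.
Proof. by rewrite prednK //; apply/card_gt0P; exists (word_of [::]). Qed.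

Local Notation MX := 'M[R]_(#|{: word}|.-1.+1).
Local Notation index := 'I_(#|{: word}|.-1.+1).

Definition row_of (w : word) : index := cast_ord (esym wordsE) (enum_rank w).
Definition label (i : index) : seq bool := wseq (enum_val (cast_ord wordsE i)).

Lemma label_row_of w : label (row_of w) = wseq w.
Proof. by rewrite /label /row_of cast_ordKV enum_rankK. Qed.

Lemma label_inj : injective label.
Proof. by move=> i j /wseq_inj/enum_val_inj/cast_ord_inj. Qed.

Lemma sum_label (F : seq bool -> R) :
  \sum_(j : index) F (label j) = \sum_(w : word) F (wseq w).
Proof.
rewrite (reindex row_of) /=; first by apply: eq_bigr => w _; rewrite label_row_of.
exists (fun i => enum_val (cast_ord wordsE i)) => i _.
  by rewrite cast_ordKV enum_rankK.
by rewrite /row_of enum_valK cast_ordK.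
Qed.

(** The operator norm for l1 on row vectors. *)
Definition mxnorm (A : MX) : R := \big[Order.max/0]_i \sum_j `|A i j|.

Lemma row_le_mxnorm (A : MX) i : \sum_j `|A i j| <= mxnorm A.
Proof. exact: le_bigmax. Qed.

Lemma mxnorm_le (A : MX) c : 0 <= c -> (forall i, \sum_j `|A i j| <= c) ->
  mxnorm A <= c.
Proof. by move=> c0 h; apply: bigmax_le. Qed.

Lemma mxnorm_ge0 (A : MX) : 0 <= mxnorm A.
Proof. exact: bigmax_ge_id. Qed.

Lemma mxnormD (A B : MX) : mxnorm (A + B) <= mxnorm A + mxnorm B.
Proof.
apply: mxnorm_le => [|i]; first by rewrite addr_ge0 ?mxnorm_ge0.
apply: le_trans (lerD (row_le_mxnorm A i) (row_le_mxnorm B i)).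
by rewrite -big_split /=; apply: ler_sum => j _; rewrite mxE ler_normD.
Qed.

Lemma mxnormZ c (A : MX) : mxnorm (c *: A) <= `|c| * mxnorm A.
Proof.
apply: mxnorm_le => [|i]; first by rewrite mulr_ge0 ?mxnorm_ge0.
under eq_bigr do rewrite mxE normrM.
by rewrite -mulr_sumr ler_wpM2l ?row_le_mxnorm.
Qed.

Lemma mxnormM (A B : MX) : mxnorm (A * B) <= mxnorm A * mxnorm B.
Proof.
apply: mxnorm_le => [|i]; first by rewrite mulr_ge0 ?mxnorm_ge0.
apply: (@le_trans _ _ (\sum_k `|A i k| * mxnorm B)); last first.
  by rewrite -mulr_suml ler_wpM2r ?mxnorm_ge0 ?row_le_mxnorm.
apply: (@le_trans _ _ (\sum_j \sum_k `|A i k| * `|B k j|)).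
  apply: ler_sum => j _; rewrite mxE (le_trans (ler_norm_sum _ _ _)) //.
  by apply: ler_sum => k _; rewrite normrM.
rewrite exchange_big /=; apply: ler_sum => k _.
by rewrite -mulr_sumr ler_wpM2l ?row_le_mxnorm.
Qed.

Lemma mxnorm1 : mxnorm 1 <= 1.
Proof.
apply: mxnorm_le => // i; rewrite (bigD1 i) //= mxE eqxx normr1 big1 ?addr0 //.
by move=> j /negPf ji; rewrite mxE eq_sym ji normr0.
Qed.

(** Right multiplication appends [b]; rows of words of length [n.+1] are zero, which is harmless
    since [n.+1] letters are read from the empty word. *)
Definition append_mx (b : bool) : MX :=
  \matrix_(i, j) (label j == rcons (label i) b)%:R.

Lemma mxnorm_append b : mxnorm (append_mx b) <= 1.
Proof.
apply: mxnorm_le => // i; case: (pickP (fun j => label j == rcons (label i) b)).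
  move=> j0 /eqP h; rewrite (bigD1 j0) //= mxE h eqxx normr1 big1 ?addr0 //.
  move=> j jj0; rewrite mxE -h (inj_eq label_inj) (negPf jj0) normr0 //.
by move=> h; rewrite big1 // => j _; rewrite mxE h normr0.
Qed.

Definition start : index := row_of (word_of [::]).

Lemma append_prodE (s : seq bool) j : (size s <= n.+1)%N ->
  (\prod_(b <- s) append_mx b) start j = (label j == s)%:R.
Proof.
elim/last_ind: s j => [|s b IHs] j hs.
  rewrite big_nil mxE -(inj_eq label_inj) /start label_row_of word_ofK // eq_sym.
  by [].
rewrite size_rcons in hs.
rewrite -cats1 big_cat big_seq1 /= cats1 mxE.
rewrite (bigD1 (row_of (word_of s))) //= IHs ?(ltnW hs) // mxE.
rewrite label_row_of word_ofK ?(ltnW hs) // eqxx mul1r big1 ?addr0 // => k.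
rewrite -(inj_eq label_inj) label_row_of word_ofK ?(ltnW hs) // => /negPf ks.
by rewrite IHs ?(ltnW hs) // ks mul0r.
Qed.

Definition trace_mx (p : nat -> R) d : MX :=
  \prod_(i < n.+1) (thinned (append_mx false) d +
     p i *: mark (append_mx false) d (append_mx true)).

(** Each factor splits over the pairs (bit, deleted or not), deletion giving the identity; expanding
    the product yields the sum over outcomes. *)
Lemma trace_probE (p : nat -> R) d j :
  trace_mx p d start j = trace_prob n p d (label j).
Proof.
pose c i (y : bool * bool) : R :=
  (if y.1 then p i else 1 - p i) * (if y.2 then d else 1 - d).
pose m (y : bool * bool) : MX := if y.2 then 1 else append_mx y.1.
have letterE (i : 'I_n.+1) : thinned (append_mx false) d +
    p i *: mark (append_mx false) d (append_mx true) = \sum_y c i y *: m y.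
  rewrite -(pair_bigA _ (fun a b => c i (a, b) *: m (a, b))) /= !big_bool /=.
  rewrite /c /m /=; apply/matrixP => a b; rewrite !mxE; ring.
rewrite /trace_mx; under eq_bigr do rewrite letterE.
rewrite bigA_distr_bigA summxE /trace_prob [RHS]big_mkcond /=.
apply: eq_bigr => x _; rewrite scaler_prod mxE -/(outcome_weight p d x).
have -> : \prod_(i < n.+1) m (x i) = \prod_(b <- trace_of x) append_mx b.
  rewrite /trace_of big_map big_filter [RHS]big_mkcond.
  rewrite [index_enum _]unlock -enumT.
  by apply: eq_bigr => i _; rewrite /m; case: (x i).2.
rewrite append_prodE; last first.
  by rewrite size_map size_filter (leq_trans (count_size _ _)) // size_enum_ord.
by rewrite eq_sym; case: eqP => _; rewrite ?mulr1 ?mulr0.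
Qed.

(** The row of the empty word lists the differences of the trace probabilities. *)
Lemma trace_tv_le (p q : nat -> R) d :
  trace_tv n p q d <= 2^-1 * mxnorm (trace_mx p d - trace_mx q d).
Proof.
rewrite /trace_tv ler_wpM2l ?invr_ge0 //.
rewrite (sig_big_dep xpredT (fun _ => xpredT)
  (fun (m : 'I_n.+2) (y : m.-tuple bool) =>
    `|trace_prob n p d y - trace_prob n q d y|)) /=.
apply: le_trans (row_le_mxnorm _ start).
rewrite -(sum_label (fun s => `|trace_prob n p d s - trace_prob n q d s|)).
by apply: ler_sum => j _; rewrite !mxE !trace_probE.
Qed.

End WordMatrices.

(** * Numerical estimates and choice of constants *)

Lemma exp_partial_sum_le (R : realType) (x : R) m : 0 <= x ->
  \sum_(k < m) k`!%:R^-1 * x ^+ k <= expR x.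
Proof.
move=> x0.
have -> : \sum_(k < m) k`!%:R^-1 * x ^+ k = series (exp_coeff x) m.
  by rewrite /series /= big_mkord exp_coeffE.
apply: nondecreasing_cvgn_le (is_cvg_series_exp_coeff x) m.
apply/nondecreasing_seqP => j.
by rewrite /series /= big_nat_recr //= lerDl exp_coeff_ge0.
Qed.

Lemma sqr_le_expn4 (R : realType) k : k%:R ^+ 2 <= 4 ^+ k :> R.
Proof.
have h : k%:R <= 2 ^+ k :> R by rewrite -natrX ler_nat ltnW // ltn_expl.
have -> : 4 = 2 ^+ 2 :> R by rewrite expr2 -natrM.
by rewrite exprAC lerXn2r // nnegrE ?exprn_ge0.
Qed.

(** Counts blocks: for [q] about [sqrt n], at least [(q - 1) / 2] blocks of length [2 q] fit. *)
Lemma le_double_div_sqr n q : (q * q <= n)%N -> (q <= 2 * (n %/ (2 * q)) + 1)%N.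
Proof.
case: (posnP q) => [-> //|q0] nq.
have hn : (n < (n %/ (2 * q)).+1 * (2 * q))%N by apply: ltn_ceil; lia.
have : (q * q < q * (2 * (n %/ (2 * q)) + 2))%N by lia.
by rewrite ltn_mul2l; lia.
Qed.

Theorem theorem3 (R : realType) :
  exists (c c' K : R) (N : nat), 0 < c /\ 0 < c' /\ 0 < K /\
    forall (n : nat), odd n -> (N <= n)%N ->
    forall (delta alpha : R),
      c / Num.sqrt n%:R <= delta -> delta <= 1 ->
      0 < alpha -> alpha <= c' * Num.sqrt n%:R ->
      (forall i : nat, (i <= n)%N -> alpha * binp n (2^-1) i <= 1) ->
      trace_tv n (S_e n alpha) (S_o n alpha) delta
        <= expR (- (K * Num.sqrt n%:R)).
Proof.
have e0 : 0 < expR 1 :> R by exact: expR_gt0.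
(* The second constant makes [8 alpha e <= s / 256], where [s = sqrt n]. The blocks gain
   [(q - 1) / 64 > (s - 2) / 64], and the net exponent is below [- s / 256] since [s >= 10]. *)
exists 1, (2048 * expR 1)^-1, 256^-1, 100%N.
split; first exact: ltr01.
split; first by rewrite invr_gt0; apply: mulr_gt0 e0; rewrite ltr0n.
split; first by rewrite invr_gt0 ltr0n.
move=> n _ n100 d alpha hd d1 alpha0 halpha _.
set s := Num.sqrt n%:R in hd halpha *.
have s0 : 0 <= s by exact: sqrtr_ge0.
have s2 : s ^+ 2 = n%:R by rewrite sqr_sqrtr.
have s10 : 10 <= s.
  rewrite -[10]ger0_norm // -sqrtr_sqr ler_wsqrtr // -natrX ler_nat //.
have sgt0 : 0 < s by lra.
have d0 : 0 < d by apply: lt_le_trans hd; rewrite divr_gt0.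
have sd : d^-1 <= s by rewrite -[s]invrK lef_pV2 ?posrE ?invr_gt0 // -div1r.
pose q := Num.truncn s; have /andP[qs sq] := truncn_itv s0; rewrite -/q in qs sq.
(* The batch size for [norm_shift_le]; [1 / d <= s] gives [4 h <= q], so blocks of length [2 q] are
   long enough. *)
pose h := Num.truncn ((4 * d)^-1).
have d40 : 0 < 4 * d by rewrite mulr_gt0.
have /andP[h1 h2] : h%:R <= (4 * d)^-1 < h.+1%:R.
  by apply: truncn_itv; rewrite invr_ge0 ltW.
have hd1 : 4 * h%:R * d <= 1.
  have := ler_wpM2r (ltW d40) h1; rewrite mulVf ?gt_eqF //; lra.
have hd2 : 1 <= 4 * h.+1%:R * d.
  have := ler_wpM2r (ltW d40) (ltW h2); rewrite mulVf ?gt_eqF //; lra.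
have q10 : (10 <= q)%N by rewrite -ltnS -(ltr_nat R) (le_lt_trans s10).
have h4q : (4 * h <= q)%N.
  rewrite -ltnS -(ltr_nat R) natrM; apply: le_lt_trans sq; apply: le_trans sd.
  by rewrite -[d^-1]mul1r ler_pdivlMr.
have hr : (4 * h.+1 <= (2 * q).+1)%N.
  by move: h q h4q q10 {h1 h2 hd1 hd2 qs sq} => {}h {}q; clear; lia.
have nq : (q * q <= n)%N.
  by rewrite -(ler_nat R) natrM -s2 expr2 ler_pM.
have Bq : (q <= 2 * (n %/ (2 * q)) + 1)%N by apply: le_double_div_sqr.
set B := (n %/ (2 * q))%N in Bq.
apply: (le_trans (trace_tv_le _ _ _ _)).
have alpha_ge0 := ltW alpha0.
have := norm_diff_le (@mxnormD R n) (@mxnormZ R n) (@mxnormM R n)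
  (mxnorm1 R n) (mxnorm_append R n false) (ltW d0) d1 (mxnorm_append R n true)
  n alpha_ge0 hd1 hd2 hr.
rewrite -/(trace_mx _ _) -/(trace_mx _ _) -/B; set X := mxnorm _ => hX.
have X0 : 0 <= X by exact: mxnorm_ge0.
(* A bound uniform in [k]: for small [k] the contraction is at most [exp (- B / 32)]; for large [k]
   one has [q <= 10 k], and [e ^ k] outweighs the loss. *)
have bnd (k : nat) : (if (20 * k <= (2 * q).+1)%N then (31 / 32) ^+ B else 1) <=
    expR 1 ^+ k * expR ((1 - q%:R) / 64) :> R.
  rewrite -expRM_natl mulr1 -expRD.
  case: ifPn => [_|]; last first.
    rewrite -ltnNge => hk; apply: le_trans (expR_ge1Dx _).
    have : (q <= 10 * k)%N by move: hk; clear; lia.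
    by rewrite -(ler_nat R) natrM; lra.
  apply: (@le_trans _ _ (expR (- 32^-1) ^+ B)).
    rewrite lerXn2r ?nnegrE ?expR_ge0 //.
    by apply: le_trans (expR_ge1Dx _); lra.
  rewrite -expRM_natl ler_expR; move: Bq; rewrite -(ler_nat R) natrD natrM.
  by have := ler0n R k; lra.
have : X <= expR (8 * alpha * expR 1) * expR ((1 - q%:R) / 64).
  apply: (le_trans hX).
  have y0 : 0 <= 8 * alpha * expR 1 by rewrite !mulr_ge0 // ltW.
  apply: le_trans (ler_wpM2r (expR_ge0 _) (exp_partial_sum_le n.+2 y0)).
  rewrite mulr_suml; apply: ler_sum => k _.
  rewrite -[X in _ <= X]mulrA ler_wpM2l ?invr_ge0 //.
  (* Bounding [k ^ 2] by [4 ^ k] leaves terms of the exponential series at [4 * 2 alpha * e]. *)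
  apply: (@le_trans _ _ (4 ^+ k * (2 * alpha) ^+ k *
     (expR 1 ^+ k * expR ((1 - q%:R) / 64)))).
    have a20 : 0 <= 2 * alpha by exact: mulr_ge0.
    apply: ler_pM (bnd k); first by rewrite mulr_ge0 ?exprn_ge0.
      by case: ifP => _; rewrite ?exprn_ge0.
    by rewrite ler_wpM2r ?sqr_le_expn4 // exprn_ge0.
  rewrite mulrA -!exprMn; set t := 4 * _ * _.
  have -> : t = 8 * alpha * expR 1 by rewrite /t; ring.
  by [].
rewrite -expRD => hX'.
apply: (@le_trans _ _ X); first by lra.
apply: (le_trans hX'); rewrite ler_expR.
have : 8 * alpha * expR 1 <= s / 256.
  have := ler_wpM2r (ltW e0) halpha.
  have -> : (2048 * expR 1)^-1 * s * expR 1 = s / 2048.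
    by field; rewrite gt_eqF.
  lra.
have : s < q%:R + 1 by rewrite natr1.
by lra.
Qed.
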